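(* Let $a$ and $b$ be positive integers. Then there exists a connected graph $G$ such that $src(G)=a$ and $src^\ell(G)=b$ if and only if $a=b=1$ or $2\le a\le b$.
   Context: All graphs are finite, simple and undirected. An edge-coloured path is rainbow if all its edges have distinct colours; a geodesic is a shortest path between its endpoints. An (not necessarily proper) edge-colouring of a connected graph $G$ is strongly rainbow connected if any two vertices are joined by a rainbow geodesic; $src(G)$ is the minimum number of colours in such a colouring. An $r$-edge-list assignment of $G$ assigns to each edge $e$ a set $L(e)\subset\mathbb N$ with $|L(e)|\ge r$; an $L$-edge-colouring is an edge-colouring $c$ with $c(e)\in L(e)$ for all $e$. $src^\ell(G)$ is the minimum integer $r$ such that for every $r$-edge-list assignment $L$ of $G$ there exists a strongly rainbow connected $L$-edge-colouring of $G$. *)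

(* Defs.v *)
From mathcomp Require Import all_boot.
From mathcomp Require Import boolp classical_sets functions cardinality.

Set Implicit Arguments.
Unset Strict Implicit.
Unset Printing Implicit Defensive.

Record sgraph := SGraph {
  vertex :> finType;
  adj : rel vertex;
  adj_sym : symmetric adj;
  adj_irr : irreflexive adj
}.

Definition edges (G : sgraph) : {set {set G}} :=
  ([set [set p.1; p.2] | p : G * G & adj p.1 p.2])%SET.

Definition connected_graph (G : sgraph) : Prop :=
  0 < #|G| /\ forall x y : G, connect (@adj G) x y.

(* As in path.v, the path x = v_0, v_1, ..., v_k = y is given by its start x
   and the sequence p = [:: v_1; ...; v_k], so that its length is size p. *)
Definition is_path (G : sgraph) (x y : G) (p : seq G) : bool :=
  [&& path (@adj G) x p, last x p == y & uniq (x :: p)].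

Definition geodesic (G : sgraph) (x y : G) (p : seq G) : Prop :=
  is_path x y p /\ forall q : seq G, is_path x y q -> size p <= size q.

Definition path_edges (G : sgraph) (x : G) (p : seq G) : seq {set G} :=
  pairmap (fun u v : G => [set u; v]%SET) x p.

(* An edge-colouring is a function on all sets of vertices, of which only the
   values on edges G are ever used; likewise for list assignments below. *)
Definition rainbow (G : sgraph) (c : {set G} -> nat) (x : G) (p : seq G) : bool :=
  uniq [seq c e | e <- path_edges x p].

Definition strongly_rainbow_connected (G : sgraph) (c : {set G} -> nat) : Prop :=
  forall x y : G, exists p : seq G, geodesic x y p /\ rainbow c x p.

Definition num_colours (G : sgraph) (c : {set G} -> nat) : nat :=
  size (undup [seq c e | e <- enum (edges G)]).

Definition is_minimum (P : nat -> Prop) (n : nat) : Prop :=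
  P n /\ forall m : nat, P m -> n <= m.

(* is_src G a stands for src(G) = a. *)
Definition is_src (G : sgraph) : nat -> Prop :=
  is_minimum (fun k => exists c : {set G} -> nat,
    strongly_rainbow_connected c /\ num_colours c = k).

(* `I_r is the set of natural numbers smaller than r, so the condition says
   that L e, which may be infinite, has at least r elements. *)
Definition edge_list_assignment (G : sgraph) (r : nat)
    (L : {set G} -> set nat) : Prop :=
  forall e : {set G}, e \in edges G -> (`I_r #<= L e)%card.

Definition list_edge_colouring (G : sgraph) (L : {set G} -> set nat)
    (c : {set G} -> nat) : Prop :=
  forall e : {set G}, e \in edges G -> L e (c e).

(* is_src_list G b stands for src^l(G) = b. *)
Definition is_src_list (G : sgraph) : nat -> Prop :=
  is_minimum (fun r => forall L : {set G} -> set nat,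
    edge_list_assignment r L ->
    exists c : {set G} -> nat,
      list_edge_colouring L c /\ strongly_rainbow_connected c).

(* Main.v *)
Require Import Defs.
From mathcomp Require Import all_boot.
From mathcomp Require Import boolp classical_sets cardinality.

(**
A colouring with one colour can only make paths of length at most one rainbow,
so src(G) = 1 forces G to be complete, and then src^l(G) = 1; and src <= src^l
because all lists may be taken equal.

For the converse, let G consist of cliques sharing exactly one vertex, the apex.
Two vertices of different cliques are joined by a unique geodesic, through the
apex, so a colouring of G is strongly rainbow connected if and only if the
spokes (the edges at the apex) to different cliques have different colours.
Hence src(G) is the number of cliques, and src^l(G) is the choice number of the
complete multipartite graph whose parts are the cliques minus the apex.  With
m = b - 1, distribute m vertices among a - 1 parts and add one part of m ^ m
vertices: colouring the m vertices first is greedy with lists of size m + 1,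
while m disjoint lists of size m on them, together with all their transversals
on the last part, admit no colouring.
*)

Set Implicit Arguments.
Unset Strict Implicit.
Unset Printing Implicit Defensive.

Lemma card_range_finType (T : finType) (U : Type) (f : T -> U) :
  injective f -> (range f #= `I_#|T|)%card.
Proof.
move=> f_inj; rewrite (card_eqr card_II).
have -> : range f = range (f \o enum_val : 'I_#|T| -> U).
  apply/seteqP; split=> [_ [t _ <-]|_ [i _ <-]]; last by exists (enum_val i).
  by exists (enum_rank t); rewrite //= enum_rankK.
by apply: inj_card_eq; apply: in2W; apply: inj_comp f_inj enum_val_inj.
Qed.

Lemma card_II_exists_notin (T : eqType) (n : nat) (A : set T) (s : seq T) :
  size s < n -> (`I_n #<= A)%card -> exists2 x, A x & x \notin s.
Proof.
move=> lt_sn le_nA; apply: contrapT => A_sub_s.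
pose S := (index^~ s @^-1` `I_(size s))%classic.
have le_AS : (A #<= S)%card.
  apply: subset_card_le => x Ax; suff: x \in s by rewrite -index_mem.
  by apply: contrapT => /negP x_notin_s; apply: A_sub_s; exists x.
have index_s_inj : {in S &, injective (index^~ s)}.
  move=> x y /set_mem xS /set_mem yS.
  by apply: (index_inj x); rewrite -index_mem.
have le_S := card_ge_preimage index_s_inj.
have := card_le_trans (card_le_trans le_nA le_AS) le_S.
by rewrite card_le_II leqNgt lt_sn.
Qed.

Lemma card_II_nonempty (T : eqType) (n : nat) (A : set T) :
  0 < n -> (`I_n #<= A)%card -> exists x, A x.
Proof.
move=> n_gt0 le_nA.
by have [x Ax _] := card_II_exists_notin (s := [::]) n_gt0 le_nA; exists x.
Qed.

Lemma exists_distinct_representatives (T : eqType) (L : T -> set nat)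
    (n : nat) (s : seq T) :
  size s <= n -> (forall t, t \in s -> (`I_n #<= L t)%card) ->
  exists k : T -> nat,
    (forall t, t \in s -> L t (k t)) /\ {in s &, injective k}.
Proof.
elim: s => [|x s IH] /= lt_sn le_nL; first by exists (fun=> 0).
have [t ts|k [kL k_inj]] := IH (ltnW lt_sn).
  by apply: le_nL; rewrite inE ts orbT.
case: (boolP (x \in s)) => [xs|x_notin_s].
  have mem_xs : x :: s =i s by move=> t; rewrite inE; case: eqP => // ->.
  by exists k; split=> [t|t u]; rewrite !mem_xs; [apply: kL | apply: k_inj].
have [||v Lxv v_new] := @card_II_exists_notin _ n (L x) (map k s).
- by rewrite size_map.
- by apply: le_nL; rewrite mem_head.
have neq_v t : t \in s -> k t != v.
  by move=> ts; apply: contraNneq v_new => <-; apply: map_f.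
exists [eta k with x |-> v]; split=> [t|t u]; rewrite !inE /=.
  by case: eqP => [->|_] //=; apply: kL.
case: (eqVneq t x) => [->|_]; case: (eqVneq u x) => [->|_] //= ts us.
- by move/esym/eqP; rewrite (negbTE (neq_v u us)).
- by move/eqP; rewrite (negbTE (neq_v t ts)).
- exact: k_inj.
Qed.

Section CompleteMultipartite.
Variables (T : finType) (K : eqType) (part : T -> K).

Definition multipartite_colouring (k : T -> nat) : Prop :=
  forall x y, part x != part y -> k x != k y.

Definition multipartite_choosable (r : nat) : Prop :=
  forall L : T -> set nat, (forall t, (`I_r #<= L t)%card) ->
  exists k : T -> nat, (forall t, L t (k t)) /\ multipartite_colouring k.

Lemma multipartite_choosable_outside_part (q : K) :
  multipartite_choosable #|[pred t | part t != q]|.+1.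
Proof.
set D := [pred t | part t != q]; move=> L le_DL.
have size_D : size (enum D) < #|D|.+1 by rewrite -cardE.
have [//|k [kL k_inj]] :=
  @exists_distinct_representatives _ L _ _ (ltnW size_D).
have /choice[h hP] t : exists h, L t h /\ h \notin map k (enum D).
  have [|h] := card_II_exists_notin (s := map k (enum D)) _ (le_DL t).
    by rewrite size_map.
  by exists h.
have neq_kh x y : x \in D -> k x != h y.
  by move=> Dx; apply: contraNneq (hP y).2 => <-; rewrite map_f ?mem_enum.
exists (fun t => if t \in D then k t else h t); split=> [t|x y neq_xy].
  by case: ifP => [Dt|_]; [apply: kL; rewrite mem_enum | case: (hP t)].
case: ifPn => Dx; case: ifPn => Dy.
- by apply: contra_neq neq_xy => /k_inj->; rewrite ?mem_enum.
- exact: neq_kh.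
- by rewrite eq_sym neq_kh.
- by move: Dx Dy neq_xy; rewrite !inE !negbK => /eqP-> /eqP->; rewrite eqxx.
Qed.

End CompleteMultipartite.

(* A choice from the rows of A * B is a transversal f, and the list of the
   vertex f consists of chosen colours only. *)
Lemma transversal_multipartite_choosable_gt (A B : finType) (K : eqType)
    (part : A + {ffun A -> B} -> K) (r : nat) :
  (forall x f, part (inl x) != part (inr f)) ->
  multipartite_choosable part r -> minn #|A| #|B| < r.
Proof.
move=> neq_part choosable_r; rewrite ltnNge leq_min.
apply/negP => /andP[le_rA le_rB].
pose code : A * B -> nat := pickle.
have le_range (S : finType) (f : S -> A * B) : injective f -> r <= #|S| ->
    (`I_r #<= range (code \o f))%card.
  move=> f_inj le_rS.
  have code_f_inj : injective (code \o f) := inj_comp (pcan_inj pickleK) f_inj.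
  by rewrite (card_le_eqr (card_range_finType code_f_inj)) card_le_II.
pose L (t : A + {ffun A -> B}) : set nat :=
  match t with
  | inl x => range (code \o pair x)
  | inr f => range (code \o (fun x => (x, f x)))
  end.
have [[x|f]|k [kL k_col]] := choosable_r L.
- by apply: le_range le_rB => y y' [].
- by apply: le_range le_rA => x x' [].
have /choice[f kE] x : exists y, k (inl x) = code (x, y).
  by have [y _ <-] := kL (inl x); exists y.
have [x _ /= kfE] := kL (inr (finfun f)).
have := k_col _ _ (neq_part x (finfun f)).
by rewrite -kfE kE ffunE eqxx.
Qed.

Section StrongRainbowConnection.
Variable G : sgraph.
Implicit Types (c : {set G} -> nat) (e : {set G}) (x y z : G).

Definition strongly_rainbow_choosable (r : nat) : Prop :=
  forall L : {set G} -> set nat, edge_list_assignment r L ->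
  exists c, list_edge_colouring L c /\ strongly_rainbow_connected c.

Lemma path_edges_sub x (p : seq G) :
  path (@adj G) x p -> {subset path_edges x p <= edges G}.
Proof.
elim: p x => [|y p IH] x //= /andP[xy yp] e; rewrite inE => /orP[/eqP->|].
  by apply/imsetP; exists (x, y); rewrite ?inE.
exact: IH.
Qed.

Lemma geodesic_refl x : geodesic x x [::].
Proof. by split; rewrite // /is_path /= eqxx. Qed.

Lemma geodesic_adj x y : adj x y -> geodesic x y [:: y].
Proof.
move=> xy; have neq_xy : x != y by apply: contraTneq xy => ->; rewrite adj_irr.
split; first by rewrite /is_path /= xy eqxx inE neq_xy.
by case=> [|z q] //; rewrite /is_path /= (negbTE neq_xy).
Qed.

Lemma geodesic_common_neighbour x y z :
  x != y -> ~~ adj x y -> adj x z -> adj z y -> geodesic x y [:: z; y].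
Proof.
move=> neq_xy nadj_xy xz zy.
have neq_xz : x != z by apply: contraTneq xz => ->; rewrite adj_irr.
have neq_zy : z != y by apply: contraTneq zy => ->; rewrite adj_irr.
split.
  by rewrite /is_path /= xz zy eqxx !inE negb_or neq_xz neq_xy neq_zy.
case=> [|w [|w' q]] //; rewrite /is_path /= ?(negbTE neq_xy) //.
by case: eqP => [->|]; rewrite /= ?(negbTE nadj_xy) ?andbF.
Qed.

Lemma geodesic_common_neighbour_inv x y z (p : seq G) :
  x != y -> ~~ adj x y -> adj x z -> adj z y -> geodesic x y p ->
  exists w, [/\ p = [:: w; y], adj x w & adj w y].
Proof.
move=> neq_xy nadj_xy xz zy [/and3P[xp last_p _] p_min].
have [zP _] := geodesic_common_neighbour neq_xy nadj_xy xz zy.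
move: (p_min _ zP) last_p xp; case: p {p_min} => [|w [|y' [|]]] //= _.
- by rewrite (negbTE neq_xy).
- by move/eqP->; rewrite (negbTE nadj_xy).
- by move/eqP->; rewrite andbT => /andP[xw wy]; exists w.
Qed.

Lemma rainbow_two_edges c x y z :
  rainbow c x [:: y; z] = (c [set x; y]%SET != c [set y; z]%SET).
Proof. by rewrite /rainbow /= inE andbT. Qed.

Lemma leq_num_colours c (s : seq {set G}) :
  {subset s <= edges G} -> uniq [seq c e | e <- s] -> size s <= num_colours c.
Proof.
move=> sE c_uniq; rewrite -(size_map c); apply: uniq_leq_size => // k.
case/mapP=> e es ->; rewrite mem_undup; apply: map_f.
by rewrite mem_enum; apply: sE.
Qed.

Lemma num_colours_leq c (k : nat) :
  (forall e, e \in edges G -> c e < k) -> num_colours c <= k.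
Proof.
move=> ck; rewrite -[leqRHS](size_iota 0); apply: uniq_leq_size.
  exact: undup_uniq.
move=> n; rewrite mem_undup => /mapP[e]; rewrite mem_enum => eE ->.
by rewrite mem_iota add0n ck.
Qed.

Lemma list_edge_colouring_exists (L : {set G} -> set nat) :
  (forall e, e \in edges G -> exists n, L e n) ->
  exists c, list_edge_colouring L c.
Proof.
move=> L_neq0; have /choice[c cL] e : exists n, e \in edges G -> L e n.
  case: (boolP (e \in edges G)) => [eE|_]; last by exists 0.
  by have [n Ln] := L_neq0 e eE; exists n.
by exists c.
Qed.

Lemma strongly_rainbow_connected_one_colour c c' :
  num_colours c <= 1 -> strongly_rainbow_connected c ->
  strongly_rainbow_connected c'.
Proof.
move=> c_le1 c_src x y; have [p [p_geo p_rb]] := c_src x y.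
exists p; split=> //.
have /and3P[xp _ _] := p_geo.1.
have := leq_trans (leq_num_colours (path_edges_sub xp) p_rb) c_le1.
by rewrite /rainbow; case: (path_edges x p) => [|e [|]].
Qed.

Lemma src1_src_list_leq1 (b : nat) : is_src G 1 -> is_src_list G b -> b <= 1.
Proof.
move=> [[c [c_src c1]] _] [_ b_min]; apply: b_min => L le_1L.
have [e eE|c' c'L] := @list_edge_colouring_exists L.
  exact: card_II_nonempty (le_1L e eE).
exists c'; split=> //.
by apply: strongly_rainbow_connected_one_colour c_src; rewrite c1.
Qed.

Lemma src_leq_src_list (a b : nat) : is_src G a -> is_src_list G b -> a <= b.
Proof.
move=> [_ a_min] [b_choosable _].
have [|c [c_lt_b c_src]] := b_choosable (fun=> `I_b).
  by move=> e _; apply: card_lexx.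
by apply: leq_trans (a_min _ _) (num_colours_leq c_lt_b); exists c.
Qed.

End StrongRainbowConnection.

Section CliqueWedge.
Variables (T K : finType) (part : T -> K).

Definition wedge_adj (u v : option T) : bool :=
  match u, v with
  | Some x, Some y => (x != y) && (part x == part y)
  | None, None => false
  | _, _ => true
  end.

Lemma wedge_adj_sym : symmetric wedge_adj.
Proof. by move=> [x|] [y|] //=; rewrite eq_sym [part x == _]eq_sym. Qed.

Lemma wedge_adj_irr : irreflexive wedge_adj.
Proof. by move=> [x|] //=; rewrite eqxx. Qed.

Definition wedge : sgraph := SGraph wedge_adj_sym wedge_adj_irr.

Definition spoke (t : T) : {set wedge} := [set None; Some t]%SET.

Lemma spoke_inj : injective spoke.
Proof.
by move=> t u /finset.setP/(_ (Some t)); rewrite !inE eqxx => /esym/eqP[].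
Qed.

Lemma spoke_edge (t : T) : spoke t \in edges wedge.
Proof. by apply/imsetP; exists (None, Some t); rewrite ?inE. Qed.

Lemma wedge_edgeP (e : {set wedge}) : e \in edges wedge ->
  (exists t, e = spoke t) \/ exists2 t, None \notin e & Some t \in e.
Proof.
case/imsetP=> -[[x|] [y|]]; rewrite !inE //= => _ ->.
- by right; exists x; rewrite !inE ?eqxx.
- by left; exists x; rewrite /spoke finset.setUC.
- by left; exists y.
Qed.

Definition on_spokes (C : Type) (f : T -> C) (g : {set wedge} -> C)
    (e : {set wedge}) : C :=
  if [pick t | e == spoke t] is Some t then f t else g e.

Lemma on_spokesE (C : Type) (f : T -> C) g (t : T) :
  on_spokes f g (spoke t) = f t.
Proof.
rewrite /on_spokes; case: pickP => [u /eqP/spoke_inj->//|/(_ t)].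
by rewrite eqxx.
Qed.

Lemma on_spokes_out (C : Type) (f : T -> C) g (e : {set wedge}) :
  None \notin e -> on_spokes f g e = g e.
Proof.
rewrite /on_spokes; case: pickP => // t /eqP->.
by rewrite !inE.
Qed.

Lemma wedge_connected : connected_graph wedge.
Proof.
split; first by apply/card_gt0P; exists None.
have to_apex (u : wedge) : connect (@adj wedge) u None.
  by case: u => [x|]; [apply: connect1|apply: connect0].
have from_apex (u : wedge) : connect (@adj wedge) None u.
  by case: u => [x|]; [apply: connect1|apply: connect0].
by move=> x y; apply: connect_trans (to_apex x) (from_apex y).
Qed.

Lemma rainbow_through_apex (c : {set wedge} -> nat) (x y : T) :
  rainbow c (Some x : wedge) [:: None; Some y] = (c (spoke x) != c (spoke y)).
Proof. by rewrite rainbow_two_edges [[set Some x; None]%SET]finset.setUC. Qed.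

Lemma strongly_rainbow_connected_wedgeP (c : {set wedge} -> nat) :
  strongly_rainbow_connected c <-> multipartite_colouring part (c \o spoke).
Proof.
have nonadj x y : part x != part y ->
    (Some x : wedge) != Some y /\ ~~ adj (Some x : wedge) (Some y).
  move=> neq_part; rewrite /= (negbTE neq_part) andbF (inj_eq Some_inj).
  by split=> //; apply: contra_neq neq_part => ->.
split=> [c_src x y neq_part|c_col u v].
  have [neq_xy nadj_xy] := nonadj x y neq_part.
  have [p [p_geo p_rb]] := c_src (Some x) (Some y).
  have [//|//|w [pE xw wy]] :=
    @geodesic_common_neighbour_inv wedge _ _ None _ neq_xy nadj_xy _ _ p_geo.
  case: w pE xw wy => [w|] pE; last by rewrite pE rainbow_through_apex in p_rb.
  by move=> /andP[_ /eqP xw] /andP[_ /eqP wy]; rewrite xw wy eqxx in neq_part.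
case: (eqVneq u v) => [<-|neq_uv].
  by exists [::]; split=> //; apply: geodesic_refl.
case: (boolP (adj u v)) => [uv|].
  by exists [:: v]; split=> //; apply: geodesic_adj.
case: u v neq_uv => [x|] [y|] // neq_xy nadj_xy.
exists [:: None; Some y]; split.
  exact: geodesic_common_neighbour.
rewrite rainbow_through_apex; apply: c_col.
by apply: contra nadj_xy => /= ->; rewrite andbT.
Qed.

Lemma card_codom_leq_num_colours (c : {set wedge} -> nat) :
  strongly_rainbow_connected c -> #|codom part| <= num_colours c.
Proof.
move=> /strongly_rainbow_connected_wedgeP c_col.
pose rep i := iinv (enum_valP i : enum_val i \in codom part).
have := @leq_num_colours wedge c (map (spoke \o rep) (enum 'I_#|codom part|)).
rewrite size_map size_enum_ord; apply=> [_ /mapP[i _ ->]|].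
  exact: spoke_edge.
rewrite -map_comp map_inj_uniq ?enum_uniq // => i j /eqP eq_c.
apply/enum_val_inj/eqP; apply: contraTT eq_c => neq_ij.
by apply: c_col; rewrite !f_iinv.
Qed.

Lemma wedge_src : is_src wedge #|codom part|.
Proof.
split=> [|m [c [c_src <-]]]; last exact: card_codom_leq_num_colours.
pose part_index t := index (part t) (enum (codom part)).
have part_index_lt t : part_index t < #|codom part|.
  by rewrite cardE index_mem mem_enum codom_f.
have c_src : strongly_rainbow_connected (on_spokes part_index (fun=> 0)).
  apply/strongly_rainbow_connected_wedgeP => x y; rewrite /= !on_spokesE.
  by apply: contra_neq => /(index_inj (part x))->; rewrite ?mem_enum ?codom_f.
exists (on_spokes part_index (fun=> 0)); split=> //.
apply/eqP; rewrite eqn_leq card_codom_leq_num_colours // andbT.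
apply: num_colours_leq => e /wedge_edgeP[[t ->]|[t Ne _]].
  by rewrite on_spokesE.
by rewrite on_spokes_out //; apply: leq_ltn_trans (part_index_lt t).
Qed.

Lemma strongly_rainbow_choosable_wedgeP (r : nat) :
  strongly_rainbow_choosable wedge r <-> multipartite_choosable part r.
Proof.
split=> r_choosable L le_rL.
  have [e eE|c [cL c_src]] := r_choosable (on_spokes L (fun=> setT)).
    case: (wedge_edgeP eE) => [[t ->]|[t Ne _]]; first by rewrite on_spokesE.
    by rewrite on_spokes_out //; apply: subset_card_le.
  exists (c \o spoke); split; last exact/strongly_rainbow_connected_wedgeP.
  by move=> t; rewrite -[L t](on_spokesE L (fun=> setT)); apply/cL/spoke_edge.
have [k [kL k_col]] := r_choosable _ (fun t => le_rL _ (spoke_edge t)).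
have [e eE|h hL] := @list_edge_colouring_exists wedge L.
  have [t _] : exists t, Some t \in e.
    case: (wedge_edgeP eE) => [[t ->]|[t _ te]]; exists t => //.
    by rewrite !inE eqxx.
  have [l [lL _]] := r_choosable (fun=> L e) (fun=> le_rL e eE).
  by exists (l t).
exists (on_spokes k h); split=> [e eE|]; last first.
  apply/strongly_rainbow_connected_wedgeP => x y.
  by rewrite /= !on_spokesE; apply: k_col.
case: (wedge_edgeP eE) => [[t ->]|[t Ne _]]; first by rewrite on_spokesE.
by rewrite on_spokes_out //; apply: hL.
Qed.

Lemma wedge_src_list (b : nat) :
  is_minimum (multipartite_choosable part) b -> is_src_list wedge b.
Proof.
move=> [b_choosable b_min]; split=> [|r].
  exact/strongly_rainbow_choosable_wedgeP.
by move=> /strongly_rainbow_choosable_wedgeP; apply: b_min.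
Qed.

End CliqueWedge.

Section TransversalParts.
Variables (A K : finType) (s : A -> K) (g : K -> A).
Hypothesis gK : cancel g s.

Definition transversal_part (t : A + {ffun A -> A}) : option K :=
  if t is inl x then Some (s x) else None.

Lemma card_codom_transversal_part : #|codom transversal_part| = #|K|.+1.
Proof.
rewrite -card_option; apply: eq_card => q; apply/codomP.
case: q => [k|]; first by exists (inl (g k)); rewrite /= gK.
by exists (inr [ffun x => x]).
Qed.

Lemma transversal_part_choice_number :
  is_minimum (multipartite_choosable transversal_part) #|A|.+1.
Proof.
split=> [|r r_choosable].
  have <- : #|[pred t | transversal_part t != None]| = #|A|.
    rewrite -(card_codom (@inl_inj A {ffun A -> A})); apply: eq_card => t.
    rewrite inE; apply/idP/codomP => [|[x ->//]].
    by case: t => [x|f] //; exists x.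
  exact: multipartite_choosable_outside_part.
rewrite -[#|A|]minnn.
exact: transversal_multipartite_choosable_gt r_choosable.
Qed.

Lemma exists_graph_src_src_list :
  exists G, [/\ connected_graph G, is_src G #|K|.+1 & is_src_list G #|A|.+1].
Proof.
exists (wedge transversal_part); split; first exact: wedge_connected.
  by rewrite -card_codom_transversal_part; apply: wedge_src.
exact/wedge_src_list/transversal_part_choice_number.
Qed.

End TransversalParts.

Theorem theorem4p2 (a b : nat) (ha : 0 < a) (hb : 0 < b) :
  (exists G : sgraph, [/\ connected_graph G, is_src G a & is_src_list G b])
  <-> (a = 1 /\ b = 1) \/ (2 <= a /\ a <= b).
Proof.
split=> [[G [_ src_a src_b]]|].
  have le_ab := src_leq_src_list src_a src_b.
  case: a ha src_a le_ab => [|[|a]] // _ src_a le_ab; last by right.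
  left; split=> //; apply/eqP.
  by rewrite eqn_leq hb andbT (src1_src_list_leq1 src_a).
case=> [[-> ->]|[]].
  have /exists_graph_src_src_list : cancel (@id 'I_0) id by [].
  by rewrite card_ord.
case: a b {ha hb} => [|[|n]] [|[|m]] // _; rewrite ltnS => le_nm.
have /exists_graph_src_src_list : cancel (widen_ord le_nm) inord.
  exact: inord_val.
by rewrite !card_ord.
Qed.
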